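(* Let $a_1,\dots,a_k$ be nonzero, multiplicatively independent integers. Let $N$ be a positive integer, and let $$ \mathcal{A} = \{a_1^{e_1} a_2^{e_2} \cdots a_k^{e_k}: \text{each } 0 \le e_i < N,\ \text{not all } e_i=0\}, $$ where the exponents $e_1,\dots,e_k$ are integers. For almost all primes $p$, there is an $a\in \mathcal{A}$ with $$ \ell_a(p) > p^{\delta}, \quad\text{where}\quad \delta = \left(1-\frac{1}{k+1}\right)\left(1-\frac{1}{N}\right). $$
   Context: For a prime $p$ and an integer $a$ not divisible by $p$, $\ell_a(p)$ denotes the multiplicative order of $a$ modulo $p$. Nonzero rational numbers $a_1,\dots,a_k$ are multiplicatively independent if whenever $a_1^{e_1}\cdots a_k^{e_k}=1$ with integers $e_1,\dots,e_k$, we have $e_1=\dots=e_k=0$. A statement holds for almost all primes $p$ if, as $x\to\infty$, the number of primes $p\le x$ for which it fails is $o(x/\log x)$.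
   Formalization: The formal theorem assumes N ≥ 2 (and k ≥ 1) instead of N positive: for N = 1 all exponents are 0, so the set 𝒜 is empty and the claim is false for every prime. *)

(* Defs.v *)
From mathcomp Require Import all_boot all_order all_algebra all_fingroup.
From mathcomp Require Import boolp classical_sets reals topology normedtype.
From mathcomp Require Import landau exp.
Set Implicit Arguments.
Unset Strict Implicit.
Unset Printing Implicit Defensive.

Import Order.TTheory GRing.Theory Num.Theory.
Import numFieldNormedType.Exports.

Local Open Scope classical_set_scope.
Local Open Scope ring_scope.

(* Meaningful for p prime and p not dividing a: when the residue of a is not
   a unit, insubd returns the trivial unit, and the value is 1. *)
Definition mult_order (a : int) (p : nat) : nat :=
  #[insubd (1%g : {unit 'F_p}) (a%:~R : 'F_p)]%g.

Definition mult_independent (k : nat) (a : 'I_k -> rat) : Prop :=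
  forall e : 'I_k -> int, \prod_(i < k) a i ^ e i = 1 -> forall i, e i = 0.

Definition power_products (k : nat) (a : 'I_k -> int) (N : nat) : set int :=
  [set b | exists e : 'I_k -> nat,
    [/\ (forall i, (e i < N)%N), (exists i, e i <> 0%N)
      & b = \prod_(i < k) a i ^+ e i]].

Definition prime_exceptions (R : realType) (P : nat -> Prop) (x : R) : nat :=
  #|[pred p : 'I_(Num.truncn x).+1 | prime p && ~~ `[< P p >]]|.

(* The little-o notation needs a bundled filter. *)
Canonical pinfty_filter_on (R : numFieldType) : filter_on R :=
  FilterType (pinfty_nbhs R) _.

Definition for_almost_all_primes (R : realType) (P : nat -> Prop) : Prop :=
  (fun x : R => (prime_exceptions P x)%:R : R^o) =o_+oo
  (fun x : R => x / ln x : R^o).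

(* Main.v *)
Require Import Defs.
From mathcomp Require Import all_boot all_order all_algebra all_fingroup.
From mathcomp Require Import all_solvable.
From mathcomp Require Import boolp classical_sets reals topology normedtype.
From mathcomp Require Import landau exp.
From mathcomp Require Import zify ring lra.
Set Implicit Arguments.
Unset Strict Implicit.
Unset Printing Implicit Defensive.

Import Order.TTheory GRing.Theory Num.Theory.
Import numFieldNormedType.Exports.

(** Fix a prime p dividing none of the a_i, and let G be the subgroup of the
multiplicative group mod p generated by their residues; write m for its order.

There are two ingredients. Firstly, G contains an element a of the required
form whose order is almost as large as m allows. The group G is cyclic; after
a choice of generator the residue of the product of the a_i^(e_i) is the
power with exponent s(e) = sum of the e_i t_i, whose order is m / gcd(m, s(e)).
Now average over the N^k - 1 nonzero exponent vectors e. Since the t_i are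
not all divisible by a prime q dividing m, a power q^j >= N dividing m divides
s(e) for at most N^(k-1) - 1 of them (all but one coordinate of e determine
the last one), while powers below N contribute only a bounded factor. Hence
the product of the gcd(m, s(e)) is at most C m^(N^(k-1) - 1)
([prod_gcdn_lincomb_dvdn]), that is
  m^(N^(k-1) (N-1)) <= C * (product over e of the order of the e-th element)
([span_le_prod_order]). If all these orders are at most p^delta, this forces
m <= C p^theta with theta = (k/(k+1)) (1 - N^(-k))
([span_le_of_no_large_order]). Leaving out e = 0 is what makes the count
N^(k-1) - 1 out of N^k - 1, a proportion strictly below 1/N; this is the
source of the factor 1 - N^(-k), which saves a power of x at the end.

Secondly, m is rarely that small. If m < (T+1)^k, two exponent vectors with
entries in [0, T] give the same residue, so p divides one of the
O(T^k) integers obtained as the numerator of (product of the a_i^(f_i)) - 1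
with f nonzero and |f_i| <= T. By multiplicative independence these are
nonzero, and each has O(T) prime factors, so only O(T^(k+1)) primes p can
occur ([card_small_span]).

With T of the order of x^(theta/k) the number of exceptional primes up to x
is O(x^(theta (k+1)/k)) = O(x^(1 - N^(-k))), which is o(x / log x). *)

(** * Divisibility of linear combinations by prime powers *)

(** The coordinate e_(i0) is determined modulo d by the others, as t_(i0) is
invertible modulo d, and hence determined outright, as it is less than d. *)
Lemma card_lincomb_dvdn (k N d : nat) (t : 'I_k.+1 -> nat) (i0 : 'I_k.+1) :
  coprime d (t i0) -> N <= d ->
  #|[pred e : {ffun 'I_k.+1 -> 'I_N} | d %| \sum_i e i * t i]| <= N ^ k.
Proof.
move=> dt leNd.
pose f (e : {ffun 'I_k.+1 -> 'I_N}) := [ffun j : 'I_k => e (lift i0 j)].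
have -> : N ^ k = #|{ffun 'I_k -> 'I_N}| by rewrite card_ffun !card_ord.
rewrite -(@card_in_image _ _ f) ?max_card // => e1 e2.
rewrite !inE => d1 d2 /ffunP eqf.
have eql j : e1 (lift i0 j) = e2 (lift i0 j) by have := eqf j; rewrite !ffunE.
have eq0 : e1 i0 = e2 i0.
  have sumE (e : {ffun 'I_k.+1 -> 'I_N}) : \sum_i e i * t i =
      e i0 * t i0 + \sum_j e (lift i0 j) * t (lift i0 j).
    by rewrite (bigD1_ord i0).
  have : e1 i0 * t i0 == e2 i0 * t i0 %[mod d].
    rewrite -(eqn_modDr (\sum_j e1 (lift i0 j) * t (lift i0 j))) -sumE.
    have -> : \sum_j e1 (lift i0 j) * t (lift i0 j) =
              \sum_j e2 (lift i0 j) * t (lift i0 j).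
      by apply: eq_bigr => j _; rewrite eql.
    by rewrite -sumE (eqP d1) (eqP d2).
  wlog le12 : e1 e2 {d1 d2 eqf eql} / e1 i0 <= e2 i0.
    move=> W; case/orP: (leq_total (e1 i0) (e2 i0)) => h eqm; first exact: W.
    by apply/esym/W => //; rewrite eq_sym.
  rewrite eq_sym eqn_mod_dvd ?leq_mul2r ?le12 ?orbT // -mulnBl.
  rewrite Gauss_dvdl // => dv; apply/val_inj/eqP.
  rewrite eqn_leq le12 /= -subn_eq0.
  case: (posnP (e2 i0 - e1 i0)) => // pos.
  have := leq_trans (dvdn_leq pos dv) (leq_subr _ _).
  by rewrite leqNgt (leq_trans (ltn_ord _) leNd).
by apply/ffunP => i; case: (unliftP i0 i) => [j|] ->.
Qed.

Lemma sum_ord_ltn (L v : nat) : \sum_(j < L) (j < v) = minn v L.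
Proof.
elim: L => [|L IH]; first by rewrite big_ord0 minn0.
by rewrite big_ord_recr /= IH; case: ltnP; lia.
Qed.

Lemma logn_sum_dvdn (q g L : nat) : prime q -> 0 < g -> logn q g <= L ->
  logn q g = \sum_(j < L) (q ^ j.+1 %| g).
Proof.
move=> q_pr g_gt0 leL; under eq_bigr do rewrite pfactor_dvdn //.
by rewrite sum_ord_ltn (minn_idPl leL).
Qed.

Definition null_vector (k n : nat) : {ffun 'I_k -> 'I_n.+1} := [ffun=> ord0].

Lemma card_nonnull (k n : nat) :
  #|[pred e : {ffun 'I_k -> 'I_n.+1} | e != null_vector k n]| = (n.+1 ^ k).-1.
Proof. by rewrite cardC1 card_ffun !card_ord. Qed.

(** The zero vector always satisfies the divisibility, so leaving it out saves
exactly one; the final saving of a power of x comes from here. *)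
Lemma card_nonnull_lincomb_dvdn (k n d : nat) (t : 'I_k.+1 -> nat)
    (i0 : 'I_k.+1) : coprime d (t i0) -> n < d ->
  #|[pred e : {ffun 'I_k.+1 -> 'I_n.+1} |
      (e != null_vector _ _) && (d %| \sum_i e i * t i)]| <= (n.+1 ^ k).-1.
Proof.
move=> dt ltnd; have := card_lincomb_dvdn dt ltnd.
rewrite (cardD1 (null_vector _ _)) inE big1 ?dvdn0 => [|i _]; last by rewrite ffunE.
by rewrite add1n => h; rewrite -ltnS prednK ?expn_gt0.
Qed.

(** Compared prime by prime: the exponent of q on the left is the number of
pairs (e, j) such that q^j divides both m and the linear combination given
by e. A power q^j > n accounts for at most (n+1)^k - 1 vectors e; for each of
the at most n powers q^j <= n all vectors are allowed, and the power of n!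
pays for these. *)
Lemma prod_gcdn_lincomb_dvdn (k n m : nat) (t : 'I_k.+1 -> nat) :
    0 < m -> (forall q, prime q -> q %| m -> exists i, ~~ (q %| t i)) ->
  \prod_(e : {ffun 'I_k.+1 -> 'I_n.+1} | e != null_vector _ _)
     gcdn m (\sum_i e i * t i)
  %| m ^ (n.+1 ^ k).-1 * n`! ^ (n * (n.+1 ^ k.+1).-1).
Proof.
move=> m_gt0 primt; set M := (n.+1 ^ k.+1).-1.
have gcd_gt0 s : 0 < gcdn m s by rewrite gcdn_gt0 m_gt0.
apply/dvdn_partP => [|q].
  by rewrite prodn_gt0.
rewrite mem_primes => /and3P[q_pr _ _].
rewrite p_part pfactor_dvdn ?muln_gt0 ?expn_gt0 ?m_gt0 ?fact_gt0 //.
rewrite lognM ?expn_gt0 ?m_gt0 ?fact_gt0 // !lognX.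
set L := logn q m.
have -> : logn q (\prod_(e : {ffun 'I_k.+1 -> 'I_n.+1} | e != null_vector _ _)
    gcdn m (\sum_i e i * t i)) = \sum_(e : {ffun 'I_k.+1 -> 'I_n.+1} |
    e != null_vector _ _) \sum_(j < L) (q ^ j.+1 %| \sum_i e i * t i).
  rewrite (big_morph_in (fun x => 0 < x) (logn q) (op1 := addn) (id1 := 0)) //.
  - apply: eq_bigr => e _.
    rewrite (@logn_sum_dvdn _ _ L) ?dvdn_leq_log ?dvdn_gcdl //.
    apply: eq_bigr => j _; rewrite dvdn_gcd.
    by rewrite pfactor_dvdn // (ltn_ord j).
  - by move=> x y; rewrite !unfold_in muln_gt0 => -> ->.
  - by move=> x y x_gt0 y_gt0; rewrite lognM.
  - by rewrite logn1.
  - by move=> e _; apply: gcd_gt0.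
rewrite exchange_big /=.
apply: (@leq_trans (\sum_(j < L) ((n.+1 ^ k).-1 + (q ^ j.+1 <= n) * M))).
  apply: leq_sum => j _; rewrite -big_mkcondr /= sum1_card.
  have [_|lt] := leqP (q ^ j.+1) n; last first.
    have qm : q %| m.
      by rewrite -[q]expn1 pfactor_dvdn // (leq_trans _ (ltn_ord j)).
    have [i qt] := primt q q_pr qm.
    by rewrite /= mul0n addn0 (card_nonnull_lincomb_dvdn (i0 := i)) //
       coprimeXl // prime_coprime.
  rewrite /= mul1n (leq_trans _ (leq_addl _ _)) // /M -card_nonnull.
  by apply: subset_leq_card; apply/fintype.subsetP => e; rewrite !inE => /andP[].
rewrite big_split /= sum_nat_const card_ord mulnC leq_add2l -big_distrl /=.
rewrite mulnAC leq_mul2r; apply/orP; right.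
have [leqn|ltnq] := leqP q n; last first.
  rewrite big1 // => j _; apply/eqP; rewrite eqb0 -ltnNge (leq_trans ltnq) //.
  by rewrite -[leqLHS]expn1 leq_exp2l ?prime_gt1.
have fq : 0 < logn q n`!.
  by rewrite -pfactor_dvdn ?fact_gt0 // expn1 dvdn_fact // prime_gt0.
apply: leq_trans (leq_pmulr _ fq).
have lt_exp j : q ^ j.+1 <= n -> j < n.
  by apply: leq_trans; apply: ltnW; apply: ltn_expl; apply: prime_gt1.
apply: (@leq_trans (\sum_(j < L) (j < n))).
  by apply: leq_sum => j _; have [/lt_exp ->|] := leqP (q ^ j.+1) n.
by rewrite sum_ord_ltn geq_minl.
Qed.

(** * Orders of the elements of a cyclic group *)

Definition span (gT : finGroupType) (k : nat) (g : 'I_k -> gT) : {set gT} :=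
  <<[set g i | i : 'I_k]>>%g.

Definition monomial (gT : finGroupType) (k : nat) (g : 'I_k -> gT)
    (e : 'I_k -> nat) : gT := (\prod_(i < k) g i ^+ e i)%g.

Lemma monomial_in_span (gT : finGroupType) (k : nat) (g : 'I_k -> gT)
    (e : 'I_k -> nat) : monomial g e \in span g.
Proof.
apply: group_prod => i _; apply: groupX; apply: mem_gen.
by apply/imsetP; exists i.
Qed.

(** Discrete logarithms of the g i. Were all of them divisible by a prime q
dividing the order of x, the g i would generate a subgroup of <[x ^+ q]>,
which is smaller than <[x]>. *)
Lemma span_cyclic_log (gT : finGroupType) (k : nat) (g : 'I_k -> gT) :
  cyclic (span g) -> exists x (t : 'I_k -> nat),
  [/\ #[x]%g = #|span g|, (forall i, g i = x ^+ t i)%g &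
      forall q, prime q -> q %| #[x]%g -> exists i, ~~ (q %| t i)].
Proof.
move=> /cyclicP[x defx].
have gx i : exists t, (g i == x ^+ t)%g.
  have : g i \in <[x]>%g by rewrite -defx mem_gen //; apply/imsetP; exists i.
  by case/cycleP => t ->; exists t.
exists x, (fun i => ex_minn (gx i)); split => [|i|q q_pr qx].
- by rewrite /order defx.
- by case: ex_minnP => t /eqP.
apply/existsP; rewrite -negb_forall; apply/negP => /forallP qt.
have sub : (<[x]> \subset <[x ^+ q]>)%g.
  rewrite -defx gen_subG; apply/fintype.subsetP => _ /imsetP[i _ ->].
  have := qt i; case: ex_minnP => t /eqP -> _ /dvdnP[u ->].
  by rewrite mulnC expgM mem_cycle.
have := subset_leq_card sub; rewrite -/(order x) -/(order (x ^+ q)%g).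
by rewrite orderXdiv // leqNgt ltn_Pdiv ?prime_gt1 ?order_gt0.
Qed.

Lemma monomial_expg (gT : finGroupType) (k : nat) (g : 'I_k -> gT) (x : gT)
    (t e : 'I_k -> nat) : (forall i, g i = x ^+ t i)%g ->
  monomial g e = (x ^+ (\sum_i e i * t i))%g.
Proof.
move=> gE; rewrite (big_morph (fun s => x ^+ s)%g (@expgD _ x) (expg0 x)).
by apply: eq_bigr => i _; rewrite gE mulnC expgM.
Qed.

(** The orders are the quotients of m by the gcds of [prod_gcdn_lincomb_dvdn];
since there are (n+1)^(k+1) - 1 nonzero vectors, dividing by
m ^ ((n+1)^k - 1) leaves the exponent (n+1)^k n on the left. *)
Lemma span_le_prod_order (gT : finGroupType) (k n : nat)
    (g : 'I_k.+1 -> gT) : cyclic (span g) ->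
  #|span g| ^ (n.+1 ^ k * n) <= n`! ^ (n * (n.+1 ^ k.+1).-1) *
    \prod_(e : {ffun 'I_k.+1 -> 'I_n.+1} | e != null_vector _ _)
      #[monomial g (fun i => e i)]%g.
Proof.
move=> /span_cyclic_log[x [t [<- gE primt]]].
set m := #[x]%g; have m_gt0 : 0 < m := order_gt0 x.
have expnk_gt0 : 0 < n.+1 ^ k by rewrite expn_gt0.
have expE : (n.+1 ^ k.+1).-1 = (n.+1 ^ k).-1 + n.+1 ^ k * n.
  by rewrite expnS; lia.
have prodE : \prod_(e : {ffun 'I_k.+1 -> 'I_n.+1} | e != null_vector _ _)
    #[monomial g (fun i => e i)]%g * \prod_(e : {ffun 'I_k.+1 -> 'I_n.+1} |
      e != null_vector _ _) gcdn m (\sum_i e i * t i) = m ^ (n.+1 ^ k.+1).-1.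
  rewrite -big_split /= (eq_bigr (fun=> m)) => [|e _].
    by rewrite prod_nat_const card_nonnull.
  by rewrite (monomial_expg _ gE) orderXgcd divnK ?dvdn_gcdl.
rewrite -(leq_pmul2l (m := m ^ (n.+1 ^ k).-1)) ?expn_gt0 ?m_gt0 // -expnD -expE.
rewrite -prodE mulnA mulnC leq_mul2r; apply/orP; right.
apply: dvdn_leq; last exact: prod_gcdn_lincomb_dvdn.
by rewrite muln_gt0 !expn_gt0 m_gt0 fact_gt0.
Qed.

Local Open Scope ring_scope.

Lemma span_le_orders (R : realType) (gT : finGroupType) (k n : nat)
    (g : 'I_k.+1 -> gT) (Y : R) : cyclic (span g) -> 0 <= Y ->
    (forall e : {ffun 'I_k.+1 -> 'I_n.+1}, e != null_vector _ _ ->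
       #[monomial g (fun i => e i)]%g%:R <= Y) ->
  #|span g|%:R ^+ (n.+1 ^ k * n) <=
    (n`! ^ (n * (n.+1 ^ k.+1).-1))%:R * Y ^+ (n.+1 ^ k.+1).-1.
Proof.
move=> cyc Y0 leY; rewrite -natrX.
apply: (@le_trans _ _ (n`! ^ (n * (n.+1 ^ k.+1).-1) *
    \prod_(e : {ffun 'I_k.+1 -> 'I_n.+1} | e != null_vector _ _)
      #[monomial g (fun i => e i)]%g)%N%:R).
  by rewrite ler_nat span_le_prod_order.
rewrite natrM ler_wpM2l // natr_prod.
apply: (@le_trans _ _ (\prod_(e : {ffun 'I_k.+1 -> 'I_n.+1} |
   e != null_vector _ _) Y)).
  by apply: ler_prod => e ne; rewrite ler0n leY.
by rewrite prodr_const card_nonnull.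
Qed.

(** * Primes for which the residues generate a small group *)

Lemma leq_exp2_size_primes (n : nat) :
  (0 < n)%N -> (2 ^ size (primes n) <= n)%N.
Proof.
move=> n_gt0; rewrite [leqRHS](prod_prime_decomp n_gt0) prime_decompE big_map /=.
rewrite -iter_muln_1 -count_predT -big_const_seq /=.
rewrite big_seq [leqRHS]big_seq; apply: leq_prod => p pn.
have p_pr : prime p by move: pn; rewrite mem_primes => /andP[].
rewrite (leq_trans (prime_gt1 p_pr)) // -[leqLHS]expn1 leq_exp2l ?prime_gt1 //.
by rewrite logn_gt0.
Qed.

Definition residue (p : nat) (a : int) : {unit 'F_p} :=
  insubd (1%g : {unit 'F_p}) (a%:~R : 'F_p).

Lemma intr_Fp_eq0 (p : nat) (b : int) : prime p ->
  (b%:~R == 0 :> 'F_p) = (p %| b)%Z.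
Proof. by move=> p_pr; rewrite (dvdz_pcharf (pchar_Fp p_pr)). Qed.

Lemma val_residue (p : nat) (b : int) : prime p -> ~~ (p %| b)%Z ->
  \val (residue p b) = b%:~R :> 'F_p.
Proof. by move=> p_pr pb; rewrite insubdK // unfold_in unitfE intr_Fp_eq0. Qed.

Lemma ndvdz_monomial (k p : nat) (a : 'I_k -> int) (e : 'I_k -> nat) :
  prime p -> (forall i, ~~ (p %| a i)%Z) -> ~~ (p %| \prod_i a i ^+ e i)%Z.
Proof.
move=> p_pr pa; rewrite -intr_Fp_eq0 // rmorph_prod /=.
by apply/prodf_neq0 => i _; rewrite rmorphXn /= expf_neq0 // intr_Fp_eq0.
Qed.

Lemma val_monomial (k p : nat) (a : 'I_k -> int) (e : 'I_k -> nat) :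
  prime p -> (forall i, ~~ (p %| a i)%Z) ->
  \val (monomial (fun i => residue p (a i)) e) = (\prod_i a i ^+ e i)%:~R :> 'F_p.
Proof.
move=> p_pr pa; rewrite rmorph_prod /=.
rewrite (big_morph _ (@FinRing.val_unitM _) (FinRing.val_unit1 _)).
by apply: eq_bigr => i _; rewrite FinRing.val_unitX val_residue // rmorphXn.
Qed.

Lemma residue_monomial (k p : nat) (a : 'I_k -> int) (e : 'I_k -> nat) :
  prime p -> (forall i, ~~ (p %| a i)%Z) ->
  residue p (\prod_i a i ^+ e i) = monomial (fun i => residue p (a i)) e.
Proof.
move=> p_pr pa; apply: val_inj.
by rewrite val_monomial // val_residue // ndvdz_monomial.
Qed.

(** The numbers whose prime divisors include every prime with a small span.
The exponent vector f - (T, ..., T) ranges over [-T, T]^k; the shift by T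
clears denominators, so that everything stays in the integers. *)
Definition exponent_gap (k : nat) (a : 'I_k -> int) (T : nat)
    (f : {ffun 'I_k -> 'I_(2 * T).+1}) : int :=
  \prod_i a i ^+ f i - \prod_i a i ^+ T.

Definition off_center (k T : nat) (f : {ffun 'I_k -> 'I_(2 * T).+1}) :=
  [exists i, f i != T :> nat].

(** Pigeonhole: two distinct vectors e1, e2 in [0, T]^k give the same element
of the span, and f = e1 - e2 + (T, ..., T) is the required vector. *)
Lemma small_span_dvd_gap (k p T : nat) (a : 'I_k -> int) :
    prime p -> (forall i, ~~ (p %| a i)%Z) ->
    (#|span (fun i => residue p (a i))| < T.+1 ^ k)%N ->
  exists2 f : {ffun 'I_k -> 'I_(2 * T).+1},
    off_center f & (p %| exponent_gap a f)%Z.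
Proof.
move=> p_pr pa small; set g := fun i => residue p (a i).
pose w (e : {ffun 'I_k -> 'I_T.+1}) := monomial g (fun i => e i).
have /injectivePn[e1 [e2 ne12 eqw]] : ~~ injectiveb w.
  apply/negP => /injectiveP injw; move: small; rewrite ltnNge => /negP; apply.
  have -> : (T.+1 ^ k)%N = #|{ffun 'I_k -> 'I_T.+1}| by rewrite card_ffun !card_ord.
  rewrite -(card_imset _ injw); apply: subset_leq_card.
  by apply/fintype.subsetP => _ /imsetP[e _ ->]; apply: monomial_in_span.
have lt_f i : (e1 i + (T - e2 i) < (2 * T).+1)%N.
  by have := ltn_ord (e1 i); have := ltn_ord (e2 i); lia.
exists [ffun i => Ordinal (lt_f i)].
  apply: contraR ne12 => /existsPn fT; apply/eqP/ffunP => i; apply: ord_inj.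
  move: (fT i); rewrite ffunE negbK /= => /eqP.
  have : (e2 i <= T)%N by rewrite -ltnS ltn_ord.
  by move: (nat_of_ord (e1 i)) (nat_of_ord (e2 i)) => u v; lia.
rewrite -intr_Fp_eq0 // rmorphB /= subr_eq0.
rewrite -!(val_monomial _ p_pr pa).
(* multiply the relation between e1 and e2 by the word with exponents T - e2 *)
set h := fun i : 'I_k => (T - e2 i)%N.
have split_w (e : 'I_k -> nat) (u : 'I_k -> nat) :
    (forall i, u i = e i + h i)%N ->
    (\prod_i a i ^+ u i)%:~R =
    (\prod_i a i ^+ e i)%:~R * (\prod_i a i ^+ h i)%:~R :> 'F_p.
  move=> uE; rewrite -rmorphM -big_split /=; congr (_%:~R).
  by apply: eq_bigr => i _; rewrite uE exprD.
rewrite !val_monomial // (split_w (fun i => e1 i)) => [|i]; last by rewrite ffunE.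
rewrite (split_w (fun i => e2 i) (fun=> T)) => [|i]; last first.
  have le_eT : (e2 i <= T)%N by rewrite -ltnS ltn_ord.
  by rewrite /h subnKC.
rewrite -!(val_monomial _ p_pr pa).
by move: eqw; rewrite /w => ->.
Qed.

Lemma exponent_gap_neq0 (k T : nat) (a : 'I_k -> int)
    (f : {ffun 'I_k -> 'I_(2 * T).+1}) :
  (forall i, a i <> 0) -> mult_independent (fun i => (a i)%:~R) ->
  off_center f -> exponent_gap a f != 0.
Proof.
move=> a0 indep /existsP[i]; apply: contra; rewrite subr_eq0 => /eqP eqa.
have a0' j : (a j)%:~R != 0 :> rat by rewrite intr_eq0; apply/eqP.
have h : \prod_j ((a j)%:~R : rat) ^ ((f j)%:Z - T%:Z) = 1.
  under eq_bigr => j _ do rewrite expfzDr // -exprnN -exprnP.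
  rewrite prodf_div -!(eq_bigr _ (fun j _ => rmorphXn _ _ _)) -!rmorph_prod /= eqa.
  rewrite divff // intr_eq0 prodf_seq_neq0; apply/allP => j _ /=.
  by rewrite expf_neq0 //; apply/eqP.
by have := indep _ h i => /=; lia.
Qed.

(** A power of 2 is a convenient bound, because it bounds the number of prime
divisors at once; it relies on H <= 2^H for H the product of the |a_i|. *)
Lemma exponent_gap_le (k T : nat) (a : 'I_k -> int)
    (f : {ffun 'I_k -> 'I_(2 * T).+1}) : (forall i, a i <> 0) ->
  (`|exponent_gap a f|%N <= 2 ^ (2 * T * \prod_i `|a i|%N).+1)%N.
Proof.
move=> a0; set H := (\prod_i `|a i|%N)%N.
have a_gt0 i : (0 < `|a i|)%N by rewrite absz_gt0; apply/eqP.
have leH (e : 'I_k -> nat) : (forall i, e i <= 2 * T)%N ->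
    (`|(\prod_i a i ^+ e i)%R|%N <= 2 ^ (2 * T * H))%N.
  move=> le_e; apply: (@leq_trans (H ^ (2 * T))%N); last first.
    rewrite (mulnC (2 * T)%N H) (expnM 2 H); case: (posnP (2 * T)%N) => [->//|T_gt0].
    by rewrite leq_exp2r // ltnW // ltn_expl.
  rewrite (big_morph absz abszM absz1).
  rewrite (big_morph (expn^~ (2 * T)%N) (fun x y => expnMn x y _) (exp1n _)).
  apply: leq_prod => i _.
  by rewrite abszX leq_pexp2l //; apply: le_e.
have h1 := leH (fun i => f i) (fun i => ltn_ord (f i)).
have h2 := leH (fun=> T) (fun=> leq_pmull T (ltn0Sn 1)).
rewrite expnS mul2n -addnn (leq_trans _ (leq_add h1 h2)) // /exponent_gap.
lia.
Qed.

(** All the primes counted divide the product H V of the |a_i| and of the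
gaps, a single nonzero integer, whose binary logarithm bounds the number of
its prime divisors; this logarithm is O(T) for each of the O(T^k) gaps. *)
Lemma card_small_span (k : nat) (a : 'I_k -> int) :
    (forall i, a i <> 0) -> mult_independent (fun i => (a i)%:~R) ->
  exists C : nat, forall X T : nat,
    (#|[pred p : 'I_X | prime p && ([exists i, (p %| a i)%Z] ||
        (#|span (fun i => residue p (a i))| < T.+1 ^ k)%N)]|
      <= C * T.+1 ^ k.+1)%N.
Proof.
move=> a0 indep; set H := (\prod_i `|a i|%N)%N.
exists (H + (2 * H).+1 * 2 ^ k)%N => X T; set P := [pred p : 'I_X | _].
have H_gt0 : (0 < H)%N.
  by rewrite prodn_gt0 // => i; rewrite absz_gt0; apply/eqP.
pose V := (\prod_(f : {ffun 'I_k -> 'I_(2 * T).+1} | off_center f)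
  `|exponent_gap a f|%N)%N.
have V_gt0 : (0 < V)%N.
  by rewrite prodn_cond_gt0 // => f fT; rewrite absz_gt0 exponent_gap_neq0.
have le_V : (V <= 2 ^ ((2 * T * H).+1 * (2 * T).+1 ^ k))%N.
  apply: (@leq_trans (\prod_(f : {ffun 'I_k -> 'I_(2 * T).+1} | off_center f)
      2 ^ (2 * T * H).+1)%N).
    by apply: leq_prod => f _; apply: exponent_gap_le.
  rewrite prod_nat_const -expnM leq_exp2l // leq_mul2l; apply/orP; right.
  by rewrite (leq_trans (max_card _)) // card_ffun !card_ord.
have le_card : (#|P| <= size (primes (H * V)))%N.
  rewrite cardE -(size_map val); apply: uniq_leq_size.
    by rewrite map_inj_uniq ?enum_uniq //; apply: val_inj.
  move=> _ /mapP[p + ->] /=; rewrite mem_enum inE => /andP[p_pr pP].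
  rewrite mem_primes p_pr muln_gt0 H_gt0 V_gt0 /=.
  case/boolP: [exists i, (p %| a i)%Z] => [/existsP[i pi]|/existsPn pa].
    by rewrite dvdn_mulr // /H (bigD1 i) //= dvdn_mulr.
  have [|f fT pf] := small_span_dvd_gap p_pr pa (T := T).
    by case/orP: pP => // /existsP[i]; rewrite (negPf (pa i)).
  by rewrite dvdn_mull // /V (bigD1 f) //= dvdn_mulr.
apply: (leq_trans le_card).
rewrite -(@leq_exp2l 2) // (leq_trans (leq_exp2_size_primes _)) ?muln_gt0 ?H_gt0 //.
apply: (leq_trans (leq_mul (ltnW (ltn_expl H (ltnSn 1))) le_V)).
rewrite -expnD leq_exp2l // mulnDl leq_add //.
  by rewrite leq_pmulr // expn_gt0.
rewrite expnS mulnACA leq_mul //; first by lia.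
by rewrite -expnMn; case: (k) => // k'; rewrite leq_exp2r //; lia.
Qed.

Local Open Scope classical_set_scope.
Local Open Scope ring_scope.

(** * Power savings and the little-o estimate *)

(** Half of the saving x^eta absorbs the logarithm, since
ln x = (2/eta) ln (x^(eta/2)) <= (2/eta) x^(eta/2); the other half tends to
infinity and absorbs the constants. *)
Lemma littleo_id_div_ln (R : realType) (f : R -> R) (B eta : R) : 0 < eta ->
    (forall x, 1 <= x -> `|f x| <= B * x `^ (1 - eta)) ->
  (f : R -> R^o) =o_+oo (fun x : R => x / ln x : R^o).
Proof.
move=> eta_gt0 f_le; apply/eqoP => eps eps_gt0.
set c := `|B| * (2 / eta) / eps.
have c_ge0 : 0 <= c.
  by rewrite !mulr_ge0 // invr_ge0 ltW.
near=> x.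
have x_gt1 : 1 < x by near: x; apply: nbhs_pinfty_gt; rewrite num_real.
have x_gt0 : 0 < x := lt_trans ltr01 x_gt1.
have ln_gt : 0 < ln x by rewrite ln_gt0.
have c_le : c <= x `^ (eta / 2).
  have : c `^ (2 / eta) <= x.
    by near: x; apply: nbhs_pinfty_ge; rewrite num_real.
  move/(ge0_ler_powR (r := eta / 2)).
  have -> : 2 / eta = (eta / 2)^-1 by rewrite invf_div.
  rewrite -powRrM mulVf ?powRr1 // ?gt_eqF ?divr_gt0 //.
  by apply; rewrite ?nnegrE ?powR_ge0 ?ltW // divr_gt0.
rewrite (ger0_norm (divr_ge0 (ltW x_gt0) (ltW ln_gt))).
rewrite (le_trans (f_le _ (ltW x_gt1))) // mulrA ler_pdivlMr //.
have powE : x = x `^ (1 - eta) * x `^ (eta / 2) * x `^ (eta / 2).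
  rewrite -!powRD ?(gt_eqF x_gt0) ?implybT //.
  by rewrite -addrA -splitr subrK powRr1 // ltW.
have ln_le : ln x <= 2 / eta * x `^ (eta / 2).
  have : ln (x `^ (eta / 2)) <= x `^ (eta / 2).
    by apply: ltW; apply: ln_sublinear; rewrite powR_gt0.
  rewrite ln_powR mulrC -ler_pdivlMr ?divr_gt0 // invf_div.
  by rewrite mulrC.
have Babs : B * x `^ (1 - eta) * ln x <= `|B| * x `^ (1 - eta) * ln x.
  by rewrite ler_pM2r // ler_wpM2r ?powR_ge0 // ler_norm.
apply: (le_trans Babs).
have := ler_wpM2l (mulr_ge0 (normr_ge0 B) (powR_ge0 x (1 - eta))) ln_le.
move=> /le_trans; apply.
rewrite [X in _ <= _ * X]powE.
move: c_le; rewrite /c ler_pdivrMr // => c_le.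
have w0 : 0 <= x `^ (1 - eta) * x `^ (eta / 2) by rewrite mulr_ge0 ?powR_ge0.
have := ler_wpM2l w0 c_le.
by rewrite !mulrA; lra.
Unshelve. all: by end_near.
Qed.

(** * Counting the exceptional primes *)

(** The form k (1 - N^(-k)) / (k + 1) of the exponent theta (here for k+1
generators) is dictated by theta N^(k-1) (N - 1) = delta (N^k - 1), the two
sides being the exponents of p in [span_le_orders]. Writing theta as k times
some s prepares for the choice of T close to x^s. *)
Lemma span_le_of_no_large_order (R : realType) (k n : nat)
    (a : 'I_k.+1 -> int) (p : nat) :
    let delta : R := (1 - 1 / (k.+1%:R + 1)) * (1 - 1 / n.+2%:R) in
    let theta : R := k.+1%:R * ((1 - (n.+2%:R ^+ k.+1)^-1) / (k.+1%:R + 1)) in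
    prime p -> (forall i, ~~ (p %| a i)%Z) ->
    ~ (exists b : int, [/\ power_products a n.+2 b, ~ (p %| b)%Z
        & (p%:R : R) `^ delta < (mult_order b p)%:R]) ->
  #|span (fun i => residue p (a i))|%:R <=
    (n.+1`! ^ (n.+1 * (n.+2 ^ k.+1).-1))%:R * p%:R `^ theta.
Proof.
move=> delta theta p_pr pa nolarge.
set C := (n.+1`! ^ _)%:R.
have C_ge1 : 1 <= C by rewrite ler1n expn_gt0 fact_gt0.
set D := (n.+2 ^ k * n.+1)%N.
have D_gt0 : (0 < D)%N by rewrite muln_gt0 expn_gt0.
have orders (e : {ffun 'I_k.+1 -> 'I_n.+2}) : e != null_vector _ _ ->
    #[monomial (fun i => residue p (a i)) (fun i => e i)]%g%:R <= p%:R `^ delta.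
  move=> e0; rewrite leNgt; apply/negP => big; apply: nolarge.
  exists (\prod_i a i ^+ e i); split.
  - exists (fun i => e i); split => //.
    suff /existsP[i ei] : [exists i, e i != 0 :> nat] by exists i; apply/eqP.
    apply: contraR e0 => /existsPn e0; apply/eqP/ffunP => i; rewrite ffunE.
    by apply: ord_inj; apply/eqP; rewrite -[_ == _]negbK; apply: e0.
  - by apply/negP; apply: ndvdz_monomial.
  - by rewrite /mult_order -/(residue _ _) residue_monomial.
have := span_le_orders (field_unit_group_cyclic _) (powR_ge0 _ _) orders.
rewrite -/D -/C => le_pow.
rewrite -(ler_pXn2r D_gt0) ?nnegrE ?mulr_ge0 ?powR_ge0 //.
apply: (le_trans le_pow); rewrite exprMn.
have -> : (p%:R `^ delta) ^+ (n.+2 ^ k.+1).-1 = (p%:R `^ theta) ^+ D :> R.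
  rewrite -!powR_mulrn ?powR_ge0 // -!powRrM; congr (_ `^ _).
  have N_neq0 : n.+2%:R != 0 :> R by rewrite pnatr_eq0.
  have K_neq0 : k.+1%:R + 1 != 0 :> R by rewrite natr1 pnatr_eq0.
  have Nk_neq0 : n.+2%:R ^+ k != 0 :> R by rewrite expf_neq0.
  have -> : (n.+2 ^ k.+1).-1%:R = n.+2%:R * n.+2%:R ^+ k - 1 :> R.
    by rewrite -subn1 natrB ?expn_gt0 // natrX exprS.
  have -> : D%:R = n.+2%:R ^+ k * (n.+2%:R - 1) :> R.
    by rewrite natrM natrX -[n.+2%:R]natr1 addrK.
  rewrite /delta /theta exprS.
  move: (n.+2%:R : R) (k.+1%:R : R) (n.+2%:R ^+ k : R) N_neq0 K_neq0 Nk_neq0.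
  by move=> x y z x0 y0 z0; field; rewrite x0 y0 z0.
by rewrite ler_wpM2r ?exprn_ge0 ?powR_ge0 // ler_eXnr.
Qed.

(** Choosing T + 1 just above C x^s makes (T+1)^k exceed the bound C x^(k s) on
the order of the span, so the exceptional primes are among those counted by
[card_small_span]; their number is O(x^((k+1) s)), and s (k+1) = 1 - N^(-k). *)
Lemma exceptions_le_powR (R : realType) (k n : nat) (a : 'I_k.+1 -> int) :
    (forall i, a i <> 0) -> mult_independent (fun i => (a i)%:~R) ->
    let delta : R := (1 - 1 / (k.+1%:R + 1)) * (1 - 1 / n.+2%:R) in
  exists B : R, forall x, 1 <= x ->
    (prime_exceptions (fun p : nat =>
      exists b : int, [/\ power_products a n.+2 b, ~ (p %| b)%Z
        & (p%:R : R) `^ delta < (mult_order b p)%:R]) x)%:R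
    <= B * x `^ (1 - (n.+2%:R ^+ k.+1)^-1).
Proof.
move=> a0 indep delta; have [C1 card_le] := card_small_span a0 indep.
set eta := (n.+2%:R ^+ k.+1)^-1.
have eta_le1 : eta <= 1.
  by rewrite invf_le1 ?exprn_gt0 ?ltr0n // exprn_ege1 // ler1n.
set C : R := (n.+1`! ^ (n.+1 * (n.+2 ^ k.+1).-1))%:R.
have C_ge1 : 1 <= C by rewrite ler1n expn_gt0 fact_gt0.
pose s : R := (1 - eta) / (k.+1%:R + 1).
have s_ge0 : 0 <= s by rewrite divr_ge0 ?subr_ge0 ?addr_ge0.
exists (C1%:R * (2 * C) ^+ k.+2) => x x_ge1.
have x_ge0 : 0 <= x by rewrite (le_trans ler01).
have xs_ge1 : 1 <= x `^ s by rewrite -(powRr0 x) ler_powR.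
set T := Num.truncn (C * x `^ s).
have T_gt : C * x `^ s < T.+1%:R := truncnS_gt _.
have T_le : T.+1%:R <= 2 * C * x `^ s.
  rewrite -natr1; have : T%:R <= C * x `^ s.
    by rewrite truncn_le mulr_ge0 // (le_trans ler01).
  have : 1 <= C * x `^ s by rewrite mulr_ege1.
  by rewrite /s; lra.
apply: (@le_trans _ _ (C1 * T.+1 ^ k.+2)%N%:R).
  rewrite ler_nat; apply: leq_trans (card_le (Num.truncn x).+1 T).
  apply: subset_leq_card; apply/fintype.subsetP => p; rewrite !inE.
  move=> /andP[p_pr /asboolPn nolarge]; rewrite p_pr /=.
  case/boolP: [exists i, (p %| a i)%Z] => //= /existsPn pa.
  rewrite -(ltr_nat R).
  apply: le_lt_trans (span_le_of_no_large_order p_pr pa nolarge) _.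
  have p_le : p%:R <= x by rewrite -truncn_ge_nat // -ltnS ltn_ord.
  rewrite -/C -/eta -/s natrX; apply: (@le_lt_trans _ _ ((C * x `^ s) ^+ k.+1)).
    rewrite exprMn; apply: ler_pM; rewrite ?powR_ge0 ?ler0n //.
      by rewrite ler_eXnr.
    rewrite -powR_mulrn ?powR_ge0 // -powRrM [s * _]mulrC.
    by rewrite ge0_ler_powR ?nnegrE ?ler0n ?(mulr_ge0 _ s_ge0) //.
  by rewrite ltrXn2r // mulr_ge0 ?powR_ge0 ?ler0n.
rewrite natrM natrX -mulrA ler_wpM2l //.
apply: (@le_trans _ _ ((2 * C * x `^ s) ^+ k.+2)).
  by rewrite lerXn2r ?nnegrE // !mulr_ge0 ?powR_ge0 // (le_trans ler01).
rewrite exprMn -[(x `^ s) ^+ _]powR_mulrn ?powR_ge0 // -powRrM.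
by rewrite /s -[k.+2%:R]natr1 divfK // natr1 pnatr_eq0.
Qed.

Theorem theorem1p2 (R : realType) (k : nat) (a : 'I_k -> int) (N : nat)
    (k_ge1 : (1 <= k)%N)
    (a_neq0 : forall i, a i <> 0)
    (a_indep : mult_independent (fun i => (a i)%:~R))
    (N_ge2 : (2 <= N)%N) :
  let delta : R := (1 - 1 / (k%:R + 1)) * (1 - 1 / N%:R) in
  for_almost_all_primes R (fun p : nat =>
    exists b : int, [/\ power_products a N b, ~ (p %| b)%Z
      & (p%:R : R) `^ delta < (mult_order b p)%:R]).
Proof.
move=> delta; rewrite /delta {delta}.
case: k a k_ge1 a_neq0 a_indep => // k a _ a_neq0 a_indep.
case: N N_ge2 => [|[|n]] // _.
have [B le_B] := exceptions_le_powR R n a_neq0 a_indep.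
apply: (@littleo_id_div_ln R _ B (n.+2%:R ^+ k.+1)^-1).
  by rewrite invr_gt0 exprn_gt0 // ltr0n.
by move=> x x_ge1; rewrite ger0_norm ?ler0n //; apply: le_B.
Qed.
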